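(* Let $(\mathfrak{g},\mathcal{B})$ be a nice $k$-step nilpotent Lie algebra with center $\mathfrak{z}$, and put $s=\dim\mathfrak{z}$ and $r=\dim(\mathfrak{g}/\mathfrak{z})$. If \[r\leq s+3,\] then $\mathfrak{g}$ has an arrow-breaking involution $\sigma$.
   Context: Lie algebras are real and finite-dimensional. A basis $\mathcal{B}=\{e_1,\dots,e_n\}$ of a Lie algebra $\mathfrak{g}$, with dual basis $\{e^1,\dots,e^n\}$, is nice if each $[e_i,e_j]$ is a multiple of a single basis element $e_k$ depending on $i,j$, and each interior product $e_i\lrcorner de^j$ (where $d$ is the Chevalley--Eilenberg differential, $de^j(x,y)=-e^j([x,y])$) is a multiple of a single $e^h$ depending on $i,j$. A nice nilpotent Lie algebra is a nilpotent Lie algebra $\mathfrak{g}$ together with a nice basis $\mathcal{B}$. Its nice diagram is the directed graph with set of nodes $\mathcal{B}$ and labeled arrows, where $x\xrightarrow{y}z$ is an arrow with source $x$, destination $z$ and label $y$ if and only if $[x,y]$ is a nonzero multiple of $z$. An arrow-breaking involution is a permutation $\sigma$ of $\mathcal{B}$ with $\sigma\circ\sigma=\mathrm{id}$ such that: (1) whenever $x$ has an incoming arrow with label $y$, then $\sigma(x)$ does not have an incoming arrow with label $\sigma(y)$; (2) whenever $x$ has an outgoing arrow with label $y$, then $\sigma(x)$ does not have an outgoing arrow with label $\sigma(y)$. *)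

(* Defs.v *)
From HB Require Import structures.
From mathcomp Require Import all_boot all_order all_fingroup all_algebra.
From mathcomp Require Export reals.

Set Implicit Arguments.
Unset Strict Implicit.
Unset Printing Implicit Defensive.

Import GRing.Theory.
Local Open Scope ring_scope.

HB.mixin Record Vector_isLieAlgebra (F : fieldType) L of Vector F L := {
  lie : L -> L -> L;
  lie_linearl : forall y, linear (lie^~ y);
  lie_linearr : forall x, linear (lie x);
  liexx : forall x, lie x x = 0;
  lie_jacobi : forall x y z,
    lie x (lie y z) + lie y (lie z x) + lie z (lie x y) = 0
}.

(* Lie algebras are finite-dimensional, since they extend vectType. *)
#[short(type="lieAlgType")]
HB.structure Definition LieAlgebra (F : fieldType) :=
  { L of Vector F L & Vector_isLieAlgebra F L }.

Reserved Notation "[< x , y >]" (at level 0, format "[<  x ,  y  >]").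
Notation "[< x , y >]" := (lie x y) : ring_scope.

Section LieAlgebraTheory.
Variables (F : fieldType) (g : lieAlgType F).
Implicit Types (U V W : {vspace g}).

HB.instance Definition _ (x : g) :=
  GRing.isLinear.Build F g g *:%R (@lie F g x) (lie_linearr x).

Definition ad (x : g) : 'End(g) := linfun (lie x).

Lemma adE (x y : g) : ad x y = [< x, y >]. Proof. exact: lfunE. Qed.

Fact ad_linear : linear ad.
Proof.
move=> a x y; apply/lfunP => z.
by rewrite !(add_lfunE, scale_lfunE, adE) (lie_linearl z a x y).
Qed.

HB.instance Definition _ := GRing.isLinear.Build F g 'End(g) *:%R ad ad_linear.

Definition center : {vspace g} := lker (linfun ad).

Lemma centerP (x : g) : reflect (forall y, [< x, y >] = 0) (x \in center).
Proof.
rewrite memv_ker lfunE /=.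
apply: (iffP eqP) => [adx0 y | h]; first by rewrite -adE adx0 lfunE.
by apply/lfunP => y; rewrite adE h lfunE.
Qed.

(* [U, V], the span of all brackets of elements of U and V; bracketsv_subP
   shows that it does not depend on the bases used. *)
Definition bracketsv U V : {vspace g} :=
  <<[seq [< x, y >] | x <- vbasis U, y <- vbasis V]>>%VS.

Lemma bracketsv_subP U V W :
  reflect {in U & V, forall x y, [< x, y >] \in W} (bracketsv U V <= W)%VS.
Proof.
apply: (iffP span_subvP) => [h x y xU yV | h _ /allpairsP[[x y] /= [xU yV ->]]].
  rewrite (coord_vbasis yV) linear_sum rpred_sum // => j _.
  rewrite linearZ rpredZ //= (coord_vbasis xU) -adE linear_sum sum_lfunE.
  apply: rpred_sum => i _.
  rewrite linearZ scale_lfunE rpredZ //= adE; apply: h.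
  by apply/allpairsP; exists ((vbasis U)`_i, (vbasis V)`_j);
    rewrite !mem_nth ?size_tuple.
by apply: h; apply: vbasis_mem.
Qed.

(* Lower central series, indexed from lcs 0 = g. *)
Fixpoint lcs (k : nat) : {vspace g} :=
  if k is k'.+1 then bracketsv fullv (lcs k') else fullv.

(* With this convention the zero Lie algebra is 0-step nilpotent, and nonzero
   abelian Lie algebras are 1-step nilpotent. *)
Definition nilpotent_of_step (k : nat) : Prop :=
  lcs k = 0%VS /\ forall m : nat, (m < k)%N -> lcs m <> 0%VS.

(* Chevalley-Eilenberg differential of a 1-form. *)
Definition ce_diff (alpha : g -> F) : g -> g -> F :=
  fun x y => - alpha [< x, y >].

Definition interior_product (x : g) (omega : g -> g -> F) : g -> F := omega x.

Section NiceBasis.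
Variables (n : nat) (e : n.-tuple g).

(* When e is a basis, coord e j is the dual basis element e^j. *)
Definition nice_basis : Prop :=
  [/\ basis_of fullv e,
      forall i j : 'I_n, exists (k : 'I_n) (c : F), [< e`_i, e`_j >] = c *: e`_k
    & forall i j : 'I_n, exists (h : 'I_n) (c : F), forall v : g,
        interior_product e`_i (ce_diff (coord e j)) v = c * coord e h v].

(* The arrow with source x, label y and destination z in the nice diagram;
   the node e`_i is represented by its index i. *)
Definition arrow (x y z : 'I_n) : Prop :=
  exists2 c : F, c != 0 & [< e`_x, e`_y >] = c *: e`_z.

Definition has_incoming (x y : 'I_n) : Prop := exists w, arrow w y x.

Definition has_outgoing (x y : 'I_n) : Prop := exists w, arrow x y w.

Definition arrow_breaking_involution (sigma : 'S_n) : Prop :=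
  [/\ forall x : 'I_n, sigma (sigma x) = x,
      forall x y, has_incoming x y -> ~ has_incoming (sigma x) (sigma y)
    & forall x y, has_outgoing x y -> ~ has_outgoing (sigma x) (sigma y)].

End NiceBasis.
End LieAlgebraTheory.

Arguments center {F} g.
Arguments lcs {F} g k.
Arguments nilpotent_of_step {F} g k.

(* Main.v *)
(** A node of the nice diagram is central when it has no outgoing arrow, and
    these nodes span the center: there are [s] of them, and [r] noncentral ones.
    Pairing noncentral nodes with central ones destroys both kinds of conflicts,
    so if [r <= s] any such pairing will do.  Otherwise [r - s] is 1, 2 or 3, and
    the corresponding number of noncentral nodes remains unpaired.

    Let [a] be a noncentral node lying as deep as possible in the lower central
    series, so that incoming arrows with label [a] only reach central nodes.
    Distinct nodes not commuting with [a] have distinct central brackets with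
    [a], so at least [r - s - 1] other noncentral nodes commute with [a]; let
    [b], [c] be the two deepest ones.  By the Jacobi identity, brackets with [b]
    or [c] that are nodes commute with [a], so incoming arrows with label [b]
    only reach [a] and central nodes, and those with label [c] only reach [a],
    [b] and central nodes.  Leaving [a], or [a] and [b], or [a], [b] and [c]
    unpaired, it suffices to exchange [a] with the last of them, and to pair the
    remaining noncentral nodes with the central ones in any way. *)

Require Import Defs.
From mathcomp Require Import all_boot all_order all_fingroup all_algebra.
From mathcomp Require Import zify.

Set Implicit Arguments.
Unset Strict Implicit.
Unset Printing Implicit Defensive.

Import GRing.Theory.
Local Open Scope ring_scope.

(** * Involutions exchanging two sets *)

(** Elements of equal index in the enumerations of [A] and [B] are exchanged; [tau] preserves the
    complement of [A :|: B], so the pieces glue. *)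
Lemma involution_pairing (T : finType) (A B : {set T}) (tau : {perm T}) :
    [disjoint A & B] -> #|A| = #|B| ->
    involutive tau -> perm_on (~: (A :|: B)) tau ->
  exists sigma : {perm T},
    [/\ involutive sigma,
        {in A, forall x, sigma x \in B},
        {in B, forall x, sigma x \in A}
      & {in ~: (A :|: B), forall x, sigma x = tau x}].
Proof.
move=> dAB eqAB tauK tauC.
pose f (X Y : {set T}) x := nth x (enum Y) (index x (enum X)).
have lt_index (X Y : {set T}) x : #|X| = #|Y| -> x \in X ->
    (index x (enum X) < size (enum Y))%N.
  by move=> eqXY xX; rewrite -cardE -eqXY cardE index_mem mem_enum.
have fP (X Y : {set T}) x : #|X| = #|Y| -> x \in X -> f X Y x \in Y.
  by move=> eqXY xX; rewrite -mem_enum mem_nth // lt_index.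
have fK (X Y : {set T}) x : #|X| = #|Y| -> x \in X -> f Y X (f X Y x) = x.
  move=> eqXY xX; rewrite /f index_uniq ?enum_uniq ?lt_index //.
  by rewrite nth_index ?mem_enum.
pose h x := if x \in A then f A B x else if x \in B then f B A x else tau x.
have hA x : x \in A -> h x = f A B x by rewrite /h => ->.
have hB x : x \in B -> h x = f B A x.
  by move=> xB; rewrite /h xB (disjointFl dAB xB).
have hC x : x \in ~: (A :|: B) -> h x = tau x.
  by rewrite /h !inE negb_or => /andP[/negPf-> /negPf->].
have hK : involutive h.
  move=> x; have [xA|xNA] := boolP (x \in A).
    by rewrite (hA x) // hB ?fP // fK.
  have [xB|xNB] := boolP (x \in B); first by rewrite (hB x) // hA ?fP // fK.
  have xC : x \in ~: (A :|: B) by rewrite !inE negb_or xNA.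
  by rewrite (hC x) // hC ?tauK // (perm_closed _ tauC).
exists (perm (can_inj hK)); split=> x; rewrite ?permE.
- exact: hK.
- by move=> xA; rewrite hA ?fP.
- by move=> xB; rewrite hB ?fP.
- exact: hC.
Qed.

(** * Elementary properties of the bracket *)

Section LieAlgebra.
Variables (F : fieldType) (g : lieAlgType F).

Lemma lieDx (x y z : g) : [< x + y, z >] = [< x, z >] + [< y, z >].
Proof. by rewrite -!adE linearD lfunE. Qed.

Lemma lieC (x y : g) : [< x, y >] = - [< y, x >].
Proof.
apply/eqP; rewrite -addr_eq0; apply/eqP.
by rewrite -(liexx (x + y)) lieDx !linearD /= !liexx add0r addr0.
Qed.

Lemma lie_lcs (x y : g) m : y \in lcs g m -> [< x, y >] \in lcs g m.+1.
Proof.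
move=> y_m; have /bracketsv_subP-> := subvv (bracketsv fullv (lcs g m)) => //.
exact: memvf.
Qed.

(** * Arrows and central nodes of a nice basis *)

Section NiceBasis.
Variables (n : nat) (e : n.-tuple g) (e_nice : nice_basis e).
Implicit Types i j h : 'I_n.

Let e_basis : basis_of fullv e. Proof. by case: e_nice. Qed.
Let e_free : free e. Proof. exact: basis_free e_basis. Qed.

Lemma nice_basis_neq0 i : e`_i != 0.
Proof.
by apply: (free_not0 e_free); rewrite mem_nth ?size_tuple.
Qed.

Lemma has_outgoingP i j : reflect (has_outgoing e i j) ([< e`_i, e`_j >] != 0).
Proof.
apply: (iffP idP) => [nz|[h [c c0 ->]]]; last first.
  by rewrite scaler_eq0 negb_or c0 nice_basis_neq0.
case: e_nice => _ /(_ i j)[h [c eq_c]] _.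
exists h, c => //; apply: contraNneq nz => c0.
by rewrite eq_c c0 scale0r.
Qed.

(** By niceness, contracting the differential of the [h]-th dual element by node [i] gives a
    multiple of one dual element. Its value at node [j] is nonzero, so that element is the
    [j]-th. *)
Lemma arrow_coord i j h : arrow e i j h ->
  exists2 c : F, c != 0 & forall v, coord e h [< e`_i, v >] = c * coord e j v.
Proof.
case=> c c0 eq_c; case: e_nice => _ _ /(_ i h)[l [d eq_d]].
have := eq_d e`_j; rewrite /interior_product /ce_diff eq_c linearZ /=.
rewrite !coord_free // eqxx mulr1 => /eqP.
have [->|_] := eqVneq j l; last by rewrite mulr0 oppr_eq0 (negPf c0).
rewrite mulr1 => /eqP eq_cd; exists c => // v.
by apply: oppr_inj; rewrite -mulNr eq_cd -eq_d.
Qed.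

Lemma arrow_label_inj i j j' h : arrow e i j h -> arrow e i j' h -> j = j'.
Proof.
move=> /arrow_coord[c c0 eq_c] [d d0 eq_d].
have := eq_c e`_j'; rewrite eq_d linearZ /= !coord_free // eqxx mulr1.
have [// |_] := eqVneq j j'.
by rewrite mulr0 => /eqP; rewrite (negPf d0).
Qed.

Definition central_nodes : {set 'I_n} :=
  [set i : 'I_n | [forall j : 'I_n, [< e`_i, e`_j >] == 0]].

Notation Z := central_nodes.

Lemma central_nodePl i j : i \in Z -> [< e`_i, e`_j >] = 0.
Proof. by rewrite inE => /forallP/(_ j)/eqP. Qed.

Lemma central_nodePr i j : i \in Z -> [< e`_j, e`_i >] = 0.
Proof. by move=> iZ; rewrite lieC central_nodePl ?oppr0. Qed.

Lemma central_node_center i : i \in Z -> e`_i \in center g.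
Proof.
move=> iZ; apply/centerP => y.
rewrite (coord_basis e_basis (memvf y)) linear_sum big1 // => j _.
by rewrite linearZ /= central_nodePl ?scaler0.
Qed.

(** A noncentral [i] labels an arrow from some [j] to some [h]. The [h]-coordinate of the bracket of
    node [j] with a central [v] vanishes, hence so does the [i]-coordinate of [v]. *)
Lemma dim_center_le : (\dim (center g) <= #|Z|)%N.
Proof.
suff sub : (center g <= <<[seq e`_(i : 'I_n) | i <- enum Z]>>)%VS.
  apply: leq_trans (dimvS sub) _.
  by apply: leq_trans (dim_span _) _; rewrite size_map cardE.
apply/subvP => v /centerP v_c.
rewrite (coord_basis e_basis (memvf v)) rpred_sum // => i _.
have [iZ|] := boolP (i \in Z).
  rewrite rpredZ // memv_span //.
  by apply: (map_f (fun j : 'I_n => e`_j)); rewrite mem_enum.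
rewrite inE negb_forall => /existsP[j].
rewrite lieC oppr_eq0 => /has_outgoingP[h /arrow_coord[c c0 /(_ v)/eqP]].
rewrite lieC v_c oppr0 linear0 eq_sym mulf_eq0 (negPf c0) => /eqP->.
by rewrite scale0r mem0v.
Qed.

(** * Depth in the lower central series *)

Variables (k : nat) (g_nil : lcs g k = 0%VS).

(** Index 0 always qualifies, so the maximum is attained; the bound [k] loses nothing, since
    [lcs g k] is zero. *)
Definition depth i : nat := \max_(m < k.+1 | e`_i \in lcs g m) m.

Lemma depth_lcs i : e`_i \in lcs g (depth i).
Proof.
have p0 : e`_i \in lcs g (@ord0 k) by rewrite memvf.
rewrite /depth (bigmax_eq_arg ord0) //.
by case: arg_maxnP.
Qed.

Lemma depth_lt i : (depth i < k)%N.
Proof.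
rewrite ltn_neqAle; apply/andP; split; last first.
  by apply/bigmax_leqP => m _; rewrite -ltnS.
apply: contra (nice_basis_neq0 i) => /eqP di.
by have := depth_lcs i; rewrite di g_nil memv0.
Qed.

Lemma has_incoming_depth i j : has_incoming e i j -> (depth j < depth i)%N.
Proof.
case=> w [c c0 eq_c].
have : [< e`_w, e`_j >] \in lcs g (depth j).+1 by apply/lie_lcs/depth_lcs.
rewrite eq_c rpredZeq (negPf c0) /= => ei.
have lt_k : ((depth j).+1 < k.+1)%N by rewrite ltnS depth_lt.
exact: (leq_bigmax_cond (Ordinal lt_k)).
Qed.

Lemma has_incoming_label i j : has_incoming e i j -> j \notin Z.
Proof.
case=> w arr; apply/negP => jZ.
have /has_outgoingP : has_outgoing e w j by exists i.
by rewrite central_nodePr ?eqxx.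
Qed.

Lemma has_outgoing_source i j : has_outgoing e i j -> i \notin Z.
Proof.
by move=> /has_outgoingP; apply: contraNN => iZ; rewrite central_nodePl.
Qed.

Lemma has_outgoing_label i j : has_outgoing e i j -> j \notin Z.
Proof.
by move=> /has_outgoingP; apply: contraNN => iZ; rewrite central_nodePr.
Qed.

(** * From the unpaired nodes to all nodes *)

(** Labels and sources of arrows are noncentral, and outside [T] the involution exchanges central
    and noncentral nodes. A conflict thus has its label or source in [T], and [closT] excludes
    destinations outside [T]. *)
Lemma extend_arrow_breaking (T : {set 'I_n}) (tau : 'S_n) :
    #|~: Z :\: T| = #|Z :\: T| ->
    involutive tau -> perm_on T tau ->
    {in T, forall y x, has_incoming e x y -> x \in Z :|: T} ->
    {in T &, forall x y,
       has_incoming e x y -> ~ has_incoming e (tau x) (tau y)} ->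
    {in T &, forall x y,
       has_outgoing e x y -> ~ has_outgoing e (tau x) (tau y)} ->
  exists sigma : 'S_n, arrow_breaking_involution e sigma.
Proof.
move=> eq_card tauK tauT closT inT outT.
have defT : ~: (~: Z :\: T :|: Z :\: T) = T.
  apply/setP => x; rewrite !(in_setC, in_setU, in_setD).
  by case: (x \in T); case: (x \in Z).
have dis : [disjoint ~: Z :\: T & Z :\: T].
  rewrite -setI_eq0; apply/eqP/setP => x.
  rewrite !(in_setI, in_setC, in_setD, in_set0).
  by case: (x \in T); case: (x \in Z).
rewrite -defT in tauT; have := involution_pairing dis eq_card tauK tauT.
rewrite defT => -[sigma [sigmaK sNZ sZN sT]].
have memT x : x \notin Z -> sigma x \notin Z -> x \in T.
  move=> xNZ; apply: contraNT => xNT.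
  have /sNZ : x \in ~: Z :\: T by rewrite in_setD xNT in_setC.
  by rewrite in_setD => /andP[].
have sT_mem x : x \in T -> sigma x \in T.
  by move=> xT; rewrite sT // -defT (perm_closed _ tauT) defT.
exists sigma; split=> // x y.
- move=> xy sxy.
  have yT := memT _ (has_incoming_label xy) (has_incoming_label sxy).
  have [xT|xNT] := boolP (x \in T).
    by move: sxy; rewrite !sT //; apply: inT.
  have /sZN : x \in Z :\: T.
    by move: (closT _ yT _ xy); rewrite in_setU in_setD xNT (negPf xNT) orbF.
  rewrite in_setD in_setC => /andP[sxNT /negPf sxNZ].
  have := closT _ (sT_mem _ yT) _ sxy.
  by rewrite in_setU sxNZ (negPf sxNT).
- move=> xy sxy.
  have xT := memT _ (has_outgoing_source xy) (has_outgoing_source sxy).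
  have yT := memT _ (has_outgoing_label xy) (has_outgoing_label sxy).
  by move: sxy; rewrite !sT //; apply: outT.
Qed.

(* The cases [a = b = c] and [a = b <> c] are those of one and two unpaired
   nodes. *)
Lemma arrow_breaking_of_three a b c :
    let T := [set a; b; c] in
    T \subset ~: Z -> #|~: Z :\: T| = #|Z| ->
    b = a \/ c <> a ->
    {in T, forall i, [< e`_a, e`_i >] = 0} ->
    (forall i, has_incoming e i a -> i \in Z) ->
    (forall i, has_incoming e i b -> i \in a |: Z) ->
    (forall i, has_incoming e i c -> i \in [set a; b] :|: Z) ->
  exists sigma : 'S_n, arrow_breaking_involution e sigma.
Proof.
move=> T /subsetP TN cardT neq comm Ia Ib Ic.
have ZD : Z :\: T = Z.
  apply/setDidPl; rewrite disjoint_sym disjoints_subset; exact/subsetP.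
have TNZ i : i \in T -> i \in Z -> False.
  by move=> /TN; rewrite in_setC => /negP.
have aT : a \in T by rewrite !inE eqxx.
have cT : c \in T by rewrite !inE eqxx orbT.
have tauT : perm_on T (tperm a c).
  apply/subsetP => i; rewrite inE => ti.
  by case: tpermP ti => [->|->|] //; rewrite eqxx.
have noout x y : x \in T -> y \in T -> has_outgoing e x y -> x <> a /\ y <> a.
  move=> xT yT /has_outgoingP xy; split=> [xa|ya].
    by rewrite xa comm ?eqxx in xy.
  by rewrite ya lieC comm ?oppr0 ?eqxx in xy.
apply: (extend_arrow_breaking (T := T) (tau := tperm a c)) => //.
- by rewrite ZD.
- exact: tpermK.
- move=> y; rewrite !inE -orbA => /or3P[]/eqP-> x.
  + by move=> /Ia xZ; rewrite in_setU xZ.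
  + move=> /Ib; rewrite !(in_setU, in_set1).
    by case/orP=> ->; rewrite ?orbT.
  + move=> /Ic; rewrite !(in_setU, in_set1).
    by case/orP=> [/orP[]|] ->; rewrite ?orbT.
(* No arrow with label [a] enters [T], and [c] is sent to [a], so the label is [b], fixed by
   [tperm a c]. Then [x = a], so [b] labels an arrow into [c], which forces [c = a]. *)
- move=> x y xT yT xy sxy.
  have TIa z : z \in T -> ~ has_incoming e z a by move=> zT /Ia/(TNZ _ zT).
  have sxT : tperm a c x \in T by rewrite perm_closed.
  have ya : y <> a by move=> ya; apply: (TIa x) => //; rewrite -ya.
  have yc : y <> c.
    by move=> yc; apply: (TIa _ sxT); move: sxy; rewrite yc tpermR.
  have yb : y = b.
    by move: yT; rewrite !inE -orbA => /or3P[]/eqP.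
  rewrite yb in ya yc xy sxy.
  have tb : tperm a c b = b by apply: tpermD; apply/eqP/nesym.
  have xa : x = a.
    by move: (Ib _ xy); rewrite in_setU1 => /orP[/eqP //|/(TNZ _ xT)].
  rewrite xa tpermL tb in sxy.
  move: (Ib _ sxy); rewrite in_setU1 => /orP[/eqP ca|/(TNZ _ cT) //].
  by case: neq.
(* As [a] commutes with [T], neither [x], [y] nor their images equal [a]; this leaves only
   [x = y = b]. *)
- move=> x y xT yT xy sxy.
  have sxT : tperm a c x \in T by rewrite perm_closed.
  have syT : tperm a c y \in T by rewrite perm_closed.
  have [xa ya] := noout _ _ xT yT xy.
  have [sxa sya] := noout _ _ sxT syT sxy.
  have eqb z : z \in T -> z <> a -> tperm a c z <> a -> z = b.
    rewrite !inE -orbA => /or3P[]/eqP->//.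
    by rewrite tpermR.
  have xb := eqb _ xT xa sxa; have yb := eqb _ yT ya sya.
  by move/has_outgoingP: xy; rewrite xb yb liexx eqxx.
Qed.

(** * Choice of the unpaired nodes *)

Lemma exists_deepest (A : {set 'I_n}) : (0 < #|A|)%N ->
  exists2 a, a \in A & {in A, forall i, depth i <= depth a}%N.
Proof.
case/card_gt0P => i0 i0A.
by have [a aA amax] := arg_maxnP depth i0A; exists a => // i /amax.
Qed.

(** Jacobi identity for [a], [w], [j]: the bracket of [w] and [a] is central and that of [a] and [j]
    is zero. *)
Lemma incoming_commutes a i j :
    (forall h, has_incoming e h a -> h \in Z) ->
    [< e`_a, e`_j >] = 0 -> has_incoming e i j ->
  [< e`_a, e`_i >] = 0.
Proof.
move=> Ia aj [w [c c0 eq_c]].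
have wa_center : [< e`_w, e`_a >] \in center g.
  have [->|] := eqVneq [< e`_w, e`_a >] 0; first exact: mem0v.
  move=> /has_outgoingP[h arr]; have [d _ ->] := arr.
  by rewrite rpredZ // central_node_center // Ia //; exists w.
have := lie_jacobi e`_a e`_w e`_j.
rewrite [[< e`_j, e`_a >]]lieC aj oppr0 linear0 addr0.
rewrite [[< e`_a, e`_w >]]lieC linearN /= [[< e`_j, _ >]]lieC.
move/centerP: wa_center => ->; rewrite !oppr0 addr0 eq_c linearZ /= => /eqP.
by rewrite scaler_eq0 (negPf c0) => /eqP.
Qed.

(** Sending [i] to the node reached by its bracket with [a] is injective by [arrow_label_inj], with
    values in [Z]. *)
Lemma card_noncommuting a :
    (forall h, has_incoming e h a -> h \in Z) ->
  (#|[set i : 'I_n | ([< e`_a, e`_i >] != 0)%R]| <= #|Z|)%N.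
Proof.
move=> Ia; pose f i := odflt i [pick h : 'I_n | [< e`_a, e`_i >] \in <[e`_h]>%VS].
have fP i : [< e`_a, e`_i >] != 0 -> arrow e a i (f i).
  move=> nz; have [h [c c0 eq_c]] := has_outgoingP a i nz.
  rewrite /f; case: pickP => [l /vlineP[d eq_d]|/(_ h)] /=.
    by exists d => //; apply: contraNneq nz => d0; rewrite eq_d d0 scale0r.
  by rewrite eq_c rpredZeq memv_line orbT.
rewrite -(card_in_imset (f := f)).
  apply/subset_leq_card/subsetP => x /imsetP[i]; rewrite inE => /fP arr ->.
  apply: Ia; exists i; have [c c0 eq_c] := arr.
  by exists (- c); rewrite ?oppr_eq0 // lieC eq_c scaleNr.
move=> i j; rewrite !inE => /fP ai /fP aj eq_f.
by apply: (@arrow_label_inj a i j (f i)) => //; rewrite eq_f.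
Qed.

Lemma nice_arrow_breaking :
  (#|~: Z| <= #|Z| + 3)%N -> exists sigma : 'S_n, arrow_breaking_involution e sigma.
Proof.
move=> le3; have [le0|gt0] := leqP #|~: Z| #|Z|.
  (* The surplus central nodes are fixed, and the others are paired with the noncentral ones. *)
  have [T TZ cardT] : exists2 T : {set 'I_n}, T \subset Z & #|T| = (#|Z| - #|~: Z|)%N.
    pose s := take (#|Z| - #|~: Z|) (enum Z).
    have sZ i : i \in s -> i \in Z by move=> /mem_take; rewrite mem_enum.
    exists [set i in s]; first by apply/subsetP => i; rewrite inE; exact: sZ.
    rewrite cardsE (card_uniqP _) ?take_uniq ?enum_uniq // size_take -cardE.
    by case: ltnP; lia.
  have TZi i : i \in T -> i \in Z by apply/subsetP.
  apply: (extend_arrow_breaking (T := T) (tau := 1%g)).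
  - have -> : ~: Z :\: T = ~: Z.
      by apply/setDidPl; rewrite disjoint_sym disjoints_subset setCK.
    by rewrite cardsD (setIidPr TZ) cardT subKn.
  - by move=> i; rewrite !perm1.
  - exact: perm_on1.
  - by move=> y /TZi yZ x /has_incoming_label; rewrite yZ.
  - by move=> x y _ /TZi yZ /has_incoming_label; rewrite yZ.
  - by move=> x y _ /TZi yZ /has_outgoing_label; rewrite yZ.
have [|a aN amax] := @exists_deepest (~: Z); first by apply: leq_trans gt0.
have Ia i : has_incoming e i a -> i \in Z.
  move=> /has_incoming_depth; rewrite ltnNge; apply: contraNT => iNZ.
  by apply: amax; rewrite in_setC.
pose M := [set i in ~: Z :\ a | [< e`_a, e`_i >] == 0].
have MP i : i \in M = [&& i != a, i \notin Z & [< e`_a, e`_i >] == 0].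
  by rewrite in_set in_setD1 in_setC andbA.
have cardM : (#|~: Z| <= #|M| + #|Z| + 1)%N.
  have := card_noncommuting Ia; set Q := [set _ | _] => cardQ.
  have sub : ~: Z \subset a |: (M :|: Q).
    apply/subsetP => i; rewrite in_setC in_setU1 in_setU MP => ->.
    by rewrite [i \in Q]in_set; case: (i == a); case: (_ == 0).
  apply: leq_trans (subset_leq_card sub) _.
  rewrite cardsU1 addnC leq_add ?leq_b1 //.
  by apply: leq_trans (leq_card_setU _ _) _; rewrite leq_add2l.
(* Here [A] holds the nodes of [M] already chosen: none for [b], then [b] alone for [c]. *)
have IM (A : {set 'I_n}) c : A \subset M -> c \in M -> {in M :\: A, forall i, depth i <= depth c}%N ->
    forall i, has_incoming e i c -> i \in a |: A :|: Z.
  move=> AM cM cmax i ic; rewrite !in_setU in_set1.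
  have := has_incoming_depth ic; rewrite ltnNge; apply: contraNT.
  rewrite !negb_or => /andP[/andP[ia iA] iZ]; apply: cmax.
  rewrite in_setD iA MP ia iZ /=; apply/eqP/(incoming_commutes Ia _ ic).
  by move: cM; rewrite MP => /and3P[_ _ /eqP].
have cardNT (T : {set 'I_n}) : T \subset ~: Z ->
    #|~: Z| = (#|T| + #|Z|)%N -> #|~: Z :\: T| = #|Z|.
  by move=> TN eqT; rewrite cardsD (setIidPr TN) eqT addKn.
have MN : M \subset ~: Z.
  by apply/subsetP => i; rewrite MP in_setC => /and3P[].
have Mc i : i \in M -> [< e`_a, e`_i >] = 0 by rewrite MP => /and3P[_ _ /eqP].
have Ma i : i \in M -> i <> a by rewrite MP => /and3P[/eqP].
have [eq1|ne1] := eqVneq #|~: Z| #|Z|.+1.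
  have TN : [set a; a; a] \subset ~: Z by rewrite !setUid sub1set.
  apply: (arrow_breaking_of_three (a := a) (b := a) (c := a) TN) => //.
  - by apply: cardNT => //; rewrite !setUid cards1 eq1.
  - by left.
  - by move=> i; rewrite !setUid => /set1P->; rewrite liexx.
  - by move=> i /Ia iZ; rewrite in_setU iZ orbT.
  - by move=> i /Ia iZ; rewrite in_setU iZ orbT.
have [|b bM bmax] := @exists_deepest M; first by lia.
have Ib i : has_incoming e i b -> i \in a |: Z.
  by rewrite -[a |: Z](setU0 _) setUAC; apply: IM; rewrite ?sub0set ?setD0.
have bN := subsetP MN _ bM.
have [eq2|ne2] := eqVneq #|~: Z| #|Z|.+2.
  have TN : [set a; a; b] \subset ~: Z by rewrite setUid subUset !sub1set aN.
  apply: (arrow_breaking_of_three (a := a) (b := a) (c := b) TN) => //.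
  - apply: cardNT => //; rewrite setUid cards2 eq2.
    by case: eqP => // /esym /(Ma _ bM).
  - by left.
  - move=> i; rewrite setUid => /set2P[]->; first by rewrite liexx.
    exact: Mc.
  - by move=> i /Ia iZ; rewrite in_setU iZ orbT.
  - by rewrite setUid.
(* Only a difference of 3 remains, so [M] has at least two nodes. *)
have [|c /setD1P[cb cM] cmax] := @exists_deepest (M :\ b).
  by have := cardsD1 b M; rewrite bM; lia.
have cN := subsetP MN _ cM.
have TN : [set a; b; c] \subset ~: Z by rewrite !subUset !sub1set aN bN.
apply: (arrow_breaking_of_three (a := a) (b := b) (c := c) TN) => //.
- apply: cardNT => //.
  have := cardsU1 c [set a; b]; rewrite setUC => ->.
  rewrite cards2 !inE negb_or cb andbT.
  have -> : c != a by apply/eqP/Ma.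
  have -> : a != b by apply/eqP => /esym; exact: Ma.
  lia.
- by right; apply: Ma.
- by move=> i; rewrite !inE -orbA => /or3P[]/eqP->; rewrite ?liexx ?Mc.
- by apply: IM; rewrite ?sub1set.
Qed.

End NiceBasis.
End LieAlgebra.

Theorem proposition3p1 (R : realType) (g : lieAlgType R) (n : nat)
    (e : n.-tuple g) (k : nat) (s r : nat) :
  nice_basis e ->
  nilpotent_of_step g k ->
  s = (\dim (center g))%N ->
  r = (\dim (fullv : {vspace g}) - \dim (center g))%N ->
  (r <= s + 3)%N ->
  exists sigma : 'S_n, arrow_breaking_involution e sigma.
Proof.
move=> e_nice [g_nil _] -> -> le3; apply: (nice_arrow_breaking e_nice g_nil).
(* As [n] is the dimension of [g], there are at most [r] noncentral nodes. *)
have := dim_center_le e_nice; have := cardsC (central_nodes e).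
have [e_basis _ _] := e_nice; have := size_basis e_basis.
rewrite card_ord; lia.
Qed.
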